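(* Let $d$ be a nonnegative integer and let $H_2(x)=(x+1)^{d+1}-x^{d+1}\in\mathbb{R}[x]$. If $H_2$ is written in the form $$H_2(x)=\sum_{i=1}^l \beta_i (x+y_i)^{e_i}$$ with real constants $\beta_i,y_i$ and nonnegative integers $e_i \leq d$ for every $i$, then $l > (d-1)/2$. *)

(* Defs.v *)
From HB Require Import structures.
From mathcomp Require Import all_boot all_order all_algebra.
From mathcomp Require Import reals.

Set Implicit Arguments.
Unset Strict Implicit.
Unset Printing Implicit Defensive.

Import GRing.Theory.
Local Open Scope ring_scope.

Definition H2 (R : realType) (d : nat) : {poly R} :=
  ('X + 1) ^+ d.+1 - 'X ^+ d.+1.

(* Main.v *)
Require Import Defs.
From HB Require Import structures.
From mathcomp Require Import all_boot all_order all_algebra.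
From mathcomp Require Import polyorder polyrcf zify.
From mathcomp Require Import reals.

(** The apolar pairing of [p] with [('X + a) ^+ e] is a multiple of
    [p^`(n - e).[a]].  Hence [('X + b) ^+ n] is not a combination of the powers
    [('X + a) ^+ n], [a] in [s], and of [l] lower powers [('X + y i) ^+ e i] as
    soon as some [p] of degree at most [n] vanishes on [s] but not at [b] and
    satisfies the [l] conditions [p^`(n - e i).[y i] = 0].  To find such a [p],
    enlarge the [l] conditions to at most [l] disjoint pairs
    [p^`(k).[x] = p^`(k.+1).[x] = 0], and let [N] be least such that [s] and the
    pairs with [k < N] impose fewer than [N] conditions.  Linear algebra gives a
    nonzero [p] of size at most [N] that satisfies them, and then all the pairs.
    If [p] also vanished at [b], then [N] would not be minimal, because the
    distinct roots of a nonzero [p], plus two for each pair with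
    [0 < k < deg p], number at most [deg p].  This is Rolle's theorem: it yields
    roots of odd multiplicity of [p^`()], which pairs alone cannot account for. *)

Set Implicit Arguments.
Unset Strict Implicit.
Unset Printing Implicit Defensive.

Import Order.TTheory GRing.Theory Num.Theory.
Local Open Scope ring_scope.

Lemma derivnS_neq0 (R : nzRingType) (p : {poly R}) (m : nat) :
  p^`(m.+1) != 0 -> p^`(m) != 0.
Proof. by apply: contraNneq; rewrite derivnS => ->; rewrite deriv0. Qed.

Lemma mu_derivn_nroot (R : realDomainType) (p : {poly R}) (x : R) :
  p != 0 -> ~~ root p^`(\mu_x p) x.
Proof.
move Em: (\mu_x p) => m; elim: m p Em => [|m IHm] p Em p0.
  by rewrite derivn0 -mu_gt0 // Em.
have rx : root p x by rewrite -mu_gt0 // Em.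
rewrite derivSn IHm ?mu_deriv ?Em ?subn1 //.
by rewrite -derivn1 -derivn_poly0 -ltnNge (@root_size_gt1 _ x).
Qed.

Lemma poly_ivt_odd_mu (R : rcfType) (p : {poly R}) (a b : R) :
    a <= b -> p.[a] * p.[b] < 0 ->
  exists2 c, c \in `]a, b[ & odd (\mu_c p).
Proof.
move=> ab; have [n] := ubnP (size p); elim: n p => // n IHn p lt_p_n pab.
have p0 : p != 0 by apply: contraTneq pab => ->; rewrite !horner0 mulr0 ltxx.
have [c cab rc] := poly_ivtoo ab pab.
have [odd_c|even_c] := boolP (odd (\mu_c p)); first by exists c.
have [q _ pE] := mu_spec c p0; set k := \mu_c p in even_c pE.
have k0 : (0 < k)%N by rewrite mu_gt0.
have q0 : q != 0 by apply: contraNneq p0 => q0; rewrite pE q0 mul0r.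
have power_gt0 x : x != c -> 0 < (x - c) ^+ k.
  by move=> xc; rewrite exprn_even_gt0 // subr_eq0 xc orbT.
have qab : q.[a] * q.[b] < 0.
  move: cab pab; rewrite in_itv pE !hornerM !horner_exp !hornerXsubC mulrACA.
  case/andP=> ac cb; rewrite pmulr_llt0 // mulr_gt0 ?power_gt0 //.
    by rewrite lt_eqF.
  by rewrite gt_eqF.
have [|x xab odd_x] := IHn q _ qab.
  move: lt_p_n; rewrite pE size_Mmonic ?monic_exp ?monicXsubC //.
  by rewrite size_exp_XsubC; lia.
exists x => //; rewrite pE mu_mul -?pE // mu_exp oddD oddM odd_x.
by rewrite (negPf even_c) andbF.
Qed.

Lemma rolle_odd_mu (R : rcfType) (p : {poly R}) (a m b : R) :
    a < m < b -> p.[a] = p.[b] -> p.[m] != p.[a] ->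
  exists2 c, c \in `]a, b[ & odd (\mu_c p^`()).
Proof.
move=> /andP[am mb] pab pma.
have [c /[!in_itv]/andP[ac cm] dpc] := poly_mvt p am.
have [d /[!in_itv]/andP[md db] dpd] := poly_mvt p mb.
have dpcd : p^`().[c] * p^`().[d] < 0.
  rewrite -(@pmulr_llt0 _ ((m - a) * (b - m))) ?mulr_gt0 ?subr_gt0 //.
  rewrite mulrACA -dpc -dpd -pab -opprB mulNr oppr_lt0 -expr2.
  by rewrite exprn_even_gt0 //= subr_eq0 eq_sym.
have cd := ltW (lt_trans cm md).
have [x /[!in_itv]/andP[cx xd] odd_x] := poly_ivt_odd_mu cd dpcd.
by exists x; rewrite // in_itv /= (lt_trans ac cx) (lt_trans xd db).
Qed.

Lemma leq_size_interlaced disp (T : orderType disp) (a : T) (s Z : seq T) :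
  path [rel x y | has [pred z | x < z < y]%O Z] a s -> (size s <= size Z)%N.
Proof.
suff between : path [rel x y | has [pred z | x < z < y]%O Z] a s ->
    exists zs, [/\ size zs = size s, path <%O a zs & {subset zs <= Z}].
  move=> /between[zs [<- azs zsZ]]; apply: uniq_leq_size zsZ.
  exact: sorted_uniq lt_trans ltxx _ (path_sorted azs).
elim: s a => [|b s IHs] a /=; first by exists [::].
case/andP=> /hasP[z zZ /= /andP[az zb]] /IHs[zs [szs bzs zsZ]].
exists (z :: zs); split=> /=; first by rewrite szs.
  by rewrite az (path_le lt_trans zb).
by move=> x /[1!inE] /predU1P[->|/zsZ].
Qed.

Lemma mem_rootsR (R : rcfType) (p : {poly R}) (x : R) :
  p != 0 -> (x \in rootsR p) = root p x.
Proof. by move=> p0; rewrite (roots_onP (roots_on_rootsR p0)) ?in_itv. Qed.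

Lemma uniq_rootsR (R : rcfType) (p : {poly R}) : uniq (rootsR p).
Proof. exact: sorted_uniq lt_trans ltxx _ (sorted_roots _ _ _). Qed.

(* Each gap between consecutive roots of [p] contains a critical point at which
   [p^`()] changes sign, and such a point is not a root of [p]. *)
Lemma leq_size_rootsR_rolle (R : rcfType) (p : {poly R}) : p != 0 ->
  (size (rootsR p) <=
   (count [pred x | ~~ root p x & odd (\mu_x p^`())] (rootsR p^`())).+1)%N.
Proof.
move=> p0; rewrite -size_filter; set Z := filter _ _.
have gaps a b s : root p a -> roots p a b = s ->
    path [rel x y | has [pred z | x < z < y] Z] a s.
  elim: s a => //= c s IHs a /rootP pa /eqP; rewrite roots_cons.
  case/and5P=> _ /[!in_itv]/andP[ac _] /eqP/(roots_nil p0) noroot rc.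
  move=> /eqP/(IHs c rc) ->.
  rewrite andbT; set m := (a + c) / 2%:R.
  have am : a < m < c by have := @mid_in_itvoo _ _ _ ac; rewrite in_itv.
  have nrm : ~~ root p m by rewrite noroot ?in_itv.
  have [||z zac odd_z] := @rolle_odd_mu _ p _ _ _ am.
  - by rewrite pa (rootP rc).
  - by rewrite pa.
  apply/hasP; exists z; last by move: zac; rewrite in_itv.
  have dp0 : p^`() != 0 by apply: contraTneq odd_z => ->; rewrite mu0.
  by rewrite mem_filter /= odd_z noroot // mem_rootsR // -mu_gt0 ?odd_gt0.
case E: (rootsR p) => [|a s] //; move/eqP: E; rewrite roots_cons ltnS.
by case/and5P=> _ _ _ ra /eqP/(gaps _ _ _ ra) => /(@leq_size_interlaced _ R).
Qed.

Section LevelPairs.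

Variable A : eqType.
Implicit Types (u t : A * nat) (K S T : seq (A * nat)).

Definition next_level u : A * nat := (u.1, u.2.+1).

Definition level_pairs T := T ++ [seq next_level t | t <- T].

Lemma next_level_inj : injective next_level.
Proof. by move=> [x i] [y j] [-> ->]. Qed.

Lemma size_level_pairs T : size (level_pairs T) = (2 * size T)%N.
Proof. by rewrite size_cat size_map addnn mul2n. Qed.

Lemma level_pairs_subseq S T :
  subseq S T -> subseq (level_pairs S) (level_pairs T).
Proof. by move=> sST; rewrite cat_subseq ?map_subseq. Qed.

(* In each maximal run [(x, i), ..., (x, j)] of [K], every other element, the
   first one included. *)
Fixpoint pair_start K x k : bool :=
  ((x, k) \in K) && (if k is j.+1 then ~~ pair_start K x j else true).

Lemma pair_cover K :
  exists T, [/\ uniq (level_pairs T), {subset T <= K}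
               & {subset K <= level_pairs T}].
Proof.
pose T := undup [seq u <- K | pair_start K u.1 u.2].
have mem_T u : (u \in T) = pair_start K u.1 u.2.
  rewrite mem_undup mem_filter andb_idr //.
  by case: u => x [|k] /= /andP[].
exists T; split=> [|u|[x k] Ku].
- rewrite cat_uniq undup_uniq map_inj_uniq ?undup_uniq ?andbT /=; last first.
    exact: next_level_inj.
  apply/hasPn => _ /mapP[[x k] + ->]; rewrite /= !mem_T /= => ->.
  by rewrite andbF.
- by rewrite mem_undup mem_filter => /andP[].
- rewrite mem_cat mem_T; case: k Ku => [|k] /= -> //=.
  have [Tk|//] := boolP (pair_start K x k).
  by rewrite (map_f next_level (x := (x, k))) // mem_T.
Qed.

Lemma leq_size_level_block T x a b : uniq (level_pairs T) ->
    {in level_pairs T, forall u, u.1 = x /\ (a <= u.2 < b)%N} ->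
  (2 * size T <= b - a)%N.
Proof.
move=> uT block; rewrite -size_level_pairs -(size_iota a (b - a)).
rewrite -[size (iota _ _)](size_map (pair x)).
apply: uniq_leq_size uT _ => -[y k] /block[/= -> lt_k].
by rewrite map_f // mem_iota; lia.
Qed.

Definition levels_below N T := [seq t <- T | (t.2 < N)%N].

Lemma size_levels_below N T : (size (levels_below N T) <= size T)%N.
Proof. by rewrite size_filter count_size. Qed.

Definition pairs_from T x a := count [pred t | (t.1 == x) && (a <= t.2)%N] T.

Lemma sum_pairs_from (Y : seq A) T a : uniq Y -> {subset unzip1 T <= Y} ->
  (\sum_(x <- Y) pairs_from T x a = count [pred t | a <= t.2] T)%N.
Proof.
move=> uY; elim: T => [|t T IHT] TY /=; first by rewrite big1_seq.
rewrite big_split /= IHT => [|x xT]; last by apply: TY; rewrite inE xT orbT.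
congr (_ + _)%N; rewrite (big_rem t.1) /=; last by rewrite TY ?mem_head.
rewrite eqxx big1_seq ?addn0 // => x /=.
by rewrite mem_rem_uniq // inE eq_sym => /andP[/negPf->].
Qed.

End LevelPairs.

Definition derivn_root (R : nzRingType) (p : {poly R}) : pred (R * nat) :=
  [pred u | root p^`(u.2) u.1].

Section Weight.

Variables (R : realDomainType) (p : {poly R}) (T : seq (R * nat)).
Hypothesis uniq_T : uniq (level_pairs T).
Hypothesis root_T : all (derivn_root p) (level_pairs T).

(* The pairs of [T] at [x] that start below level [m + \mu_x p^`(m)] are
   accounted for by the multiplicity. *)
Definition weight m x :=
  (\mu_x p^`(m) + 2 * pairs_from T x (m + \mu_x p^`(m)))%N.

Lemma leq_pairs_from_mu x m a : p^`(m) != 0 -> (m <= a)%N ->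
  (2 * pairs_from T x a <=
   m + \mu_x p^`(m) - a + 2 * pairs_from T x (m + \mu_x p^`(m)))%N.
Proof.
set e := (m + _)%N => pm0 le_ma.
pose S := [seq t <- T | (t.1 == x) && (a <= t.2 < e)%N].
have in_block t : t \in T -> t.1 = x -> (t.2 < e)%N -> (t.2.+1 < e)%N.
  move=> tT tx lt_te; rewrite ltn_neqAle lt_te andbT.
  apply: contraNneq (mu_derivn_nroot x pm0) => eE.
  have : root p^`(t.2.+1) t.1.
    by apply: (allP root_T (next_level t)); rewrite mem_cat map_f ?orbT.
  by rewrite tx eE /e addnC /derivn iterD.
have S_block : (2 * size S <= e - a)%N.
  apply: (@leq_size_level_block _ S x a).
    by apply: subseq_uniq uniq_T; rewrite level_pairs_subseq ?filter_subseq.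
  move=> u; rewrite mem_cat => /orP[|/mapP[t + ->]];
    rewrite mem_filter => /andP[/and3P[/eqP tx le_a lt_e] tT].
    by rewrite le_a.
  by rewrite /= leqW // in_block.
suff : (pairs_from T x a <= size S + pairs_from T x e)%N by lia.
rewrite size_filter -count_predUI; apply: leq_trans (leq_addr _ _).
by apply: sub_count => t /= /andP[-> ->]; case: ltnP.
Qed.

Lemma leq_root_weight0 x : p != 0 ->
  (root p x + 2 * pairs_from T x 1 <= weight 0 x)%N.
Proof.
move=> p0; have := @leq_pairs_from_mu x 0 1 p0 isT.
rewrite /weight derivn0 -mu_gt0 //; lia.
Qed.

Lemma leq_weight_succ x m : p^`(m.+1) != 0 ->
  (weight m x + (~~ root p^`(m) x && odd (\mu_x p^`(m.+1)))
     <= weight m.+1 x + root p^`(m) x)%N.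
Proof.
move=> dpm0; have pm0 := derivnS_neq0 dpm0.
have [rx|nrx] := boolP (root p^`(m) x).
  have muE := mu_deriv_root pm0 rx.
  by rewrite /weight derivnS muE !addn1 addnS !addSn addn0.
have skip_m : pairs_from T x m = pairs_from T x m.+1.
  apply: eq_in_count => t tT /=; rewrite [in LHS]leq_eqVlt.
  have [tx|//] := eqVneq t.1 x; have [tm|//] := eqVneq m t.2.
  have : root p^`(t.2) t.1 by apply: (allP root_T t); rewrite mem_cat tT.
  by rewrite tx -tm (negPf nrx).
have := @leq_pairs_from_mu x m.+1 m.+1 dpm0 (leqnn _).
rewrite /weight (muNroot nrx) !addn0 skip_m addKn; lia.
Qed.

End Weight.

Section RootCount.

Variables (R : rcfType) (p : {poly R}) (T : seq (R * nat)).
Hypothesis uniq_T : uniq (level_pairs T).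
Hypothesis root_T : all (derivn_root p) (level_pairs T).

Lemma leq_sum_weight_succ (Y : seq R) m : p^`(m.+1) != 0 ->
    uniq Y -> {subset rootsR p^`(m.+1) <= Y} ->
  (\sum_(x <- Y) weight p T m x <= (\sum_(x <- Y) weight p T m.+1 x).+1)%N.
Proof.
move=> dpm0 uY sY; have pm0 := derivnS_neq0 dpm0.
have rolle : (\sum_(x <- Y) root p^`(m) x <=
    (\sum_(x <- Y) (~~ root p^`(m) x && odd (\mu_x p^`(m.+1)))).+1)%N.
  rewrite -!big_mkcond /= !sum1_count.
  apply: leq_trans (leq_trans (leq_size_rootsR_rolle pm0) _).
    rewrite -size_filter uniq_leq_size ?filter_uniq // => x.
    by rewrite mem_filter mem_rootsR // => /andP[].
  rewrite ltnS -!size_filter uniq_leq_size ?filter_uniq ?uniq_rootsR // => x.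
  by rewrite !mem_filter => /andP[odd_x /sY Yx]; apply/andP.
suff : (\sum_(x <- Y) weight p T m x
    + \sum_(x <- Y) (~~ root p^`(m) x && odd (\mu_x p^`(m.+1)))
  <= \sum_(x <- Y) weight p T m.+1 x + \sum_(x <- Y) root p^`(m) x)%N by lia.
by rewrite -!big_split; apply: leq_sum => x _; apply: leq_weight_succ.
Qed.

Lemma leq_sum_weight (Y : seq R) m : p^`(m) != 0 -> uniq Y ->
    (forall k, (k <= m)%N -> {subset rootsR p^`(k) <= Y}) ->
  (\sum_(x <- Y) weight p T 0 x <= \sum_(x <- Y) weight p T m x + m)%N.
Proof.
move=> + uY; elim: m => [|m IHm] dpm0 sY; first by rewrite addn0.
have pm0 := derivnS_neq0 dpm0.
have {}IHm := IHm pm0 (fun k le_km => sY k (leqW le_km)).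
rewrite addnS -addSn (leq_trans IHm) //.
by rewrite leq_add2r leq_sum_weight_succ //; apply: sY.
Qed.

Lemma leq_roots_sum_weight0 (Y s : seq R) : p != 0 ->
    uniq Y -> {subset unzip1 T <= Y} -> {subset s <= Y} ->
    all [pred t | 0 < t.2]%N T -> uniq s -> all (root p) s ->
  (size s + 2 * size T <= \sum_(x <- Y) weight p T 0 x)%N.
Proof.
move=> p0 uY TY sY T_gt0 us rs.
have -> : size T = (\sum_(x <- Y) pairs_from T x 1)%N.
  by rewrite sum_pairs_from //; apply/esym/eqP; rewrite -all_count.
have : (size s <= \sum_(x <- Y) root p x)%N.
  rewrite -big_mkcond sum1_count -size_filter uniq_leq_size // => x sx.
  by rewrite mem_filter (allP rs) ?sY.
rewrite -(leq_add2r (2 * \sum_(x <- Y) pairs_from T x 1)) => /leq_trans; apply.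
by rewrite big_distrr -big_split leq_sum // => x _; apply: leq_root_weight0.
Qed.

Lemma max_poly_roots_pairs (s : seq R) : p != 0 -> all [pred t | 0 < t.2]%N T ->
    uniq s -> all (root p) s ->
  (size s + 2 * size (levels_below (size p).-1 T) < size p)%N.
Proof.
move=> p0 T_gt0 us rs; set n := (size p).-1.
have size_p : size p = n.+1 by rewrite polySpred.
have pn0 : p^`(n) != 0 by rewrite -derivn_poly0 size_p ltnn.
pose Y := undup
  (s ++ unzip1 T ++ flatten [seq rootsR p^`(m) | m <- iota 0 n.+1]).
have uY : uniq Y := undup_uniq _.
have sY : {subset s <= Y} by move=> x sx; rewrite mem_undup mem_cat sx.
have TY : {subset unzip1 T <= Y}.
  by move=> x Tx; rewrite mem_undup !mem_cat Tx orbT.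
have rootsY m : (m <= n)%N -> {subset rootsR p^`(m) <= Y}.
  move=> le_mn x rx; rewrite mem_undup mem_cat mem_cat; apply/or3P/Or33.
  by apply/flatten_mapP; exists m; rewrite ?mem_iota.
have last_weight : (\sum_(x <- Y) weight p T n x =
    2 * count [pred t | n <= t.2] T)%N.
  have pnE : p^`(n) = (p^`(n)`_0)%:P.
    apply: size1_polyC.
    by rewrite derivn_poly0 derivn1 -derivnS -derivn_poly0 size_p.
  rewrite -(sum_pairs_from n uY TY) big_distrr /=; apply: eq_bigr => x _.
  by rewrite /weight pnE mu_polyC addn0.
have -> : size (levels_below n T) = count (predC [pred t | n <= t.2]%N) T.
  by rewrite size_filter; apply: eq_count => t; rewrite /= ltnNge.
have := leq_roots_sum_weight0 p0 uY TY sY T_gt0 us rs.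
have := leq_sum_weight pn0 uY rootsY; rewrite last_weight size_p.
by rewrite -(count_predC [pred t | n <= t.2]%N T); lia.
Qed.

End RootCount.

Lemma exists_poly_derivn_roots (F : fieldType) (N : nat) (K : seq (F * nat)) :
    (size K < N)%N ->
  exists p : {poly F}, [/\ p != 0, (size p <= N)%N & all (derivn_root p) K].
Proof.
move=> lt_KN; pose u (j : 'I_(size K)) := tnth (in_tuple K) j.
pose M := \matrix_(i < N, j < size K) ('X^i)^`((u j).2).[(u j).1].
have : kermx M != 0.
  rewrite -mxrank_eq0 mxrank_ker subn_eq0 -ltnNge.
  exact: leq_ltn_trans (rank_leq_col M) lt_KN.
case/rowV0Pn => v /sub_kermxP vM v0; exists (rVpoly v); split.
- by apply: contraNneq v0 => /(canRL rVpolyK) ->; rewrite linear0.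
- exact: size_poly.
apply/(all_tnthP (t := in_tuple K)) => j; apply/eqP.
have /rowP/(_ j) := vM; rewrite !mxE => <-.
rewrite [v in LHS]row_sum_delta !linear_sum horner_sum; apply: eq_bigr => i _.
by rewrite !linearZ /= hornerZ rVpoly_delta mxE.
Qed.

Lemma derivn_root_levels_below (R : nzRingType) (p : {poly R}) (N : nat)
    (T : seq (R * nat)) : (size p <= N)%N ->
    all (derivn_root p) (level_pairs (levels_below N T)) ->
  all (derivn_root p) (level_pairs T).
Proof.
move=> le_pN root_low; apply/allP => u; rewrite mem_cat => Tu.
have [lt_uN|le_Nu] := ltnP u.2 N; last first.
  by rewrite /derivn_root /= poly.derivn_poly0 ?root0 // (leq_trans le_pN).
apply: (allP root_low); rewrite mem_cat.
case/orP: Tu lt_uN => [Tu|/mapP[t Tt ->]] lt_N.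
  by rewrite mem_filter lt_N Tu.
by rewrite map_f ?orbT // mem_filter Tt andbT ltnW.
Qed.

Lemma exists_separating_poly (R : rcfType) (K : seq (R * nat)) (s : seq R)
    (b : R) : uniq (b :: s) -> all [pred u | 0 < u.2]%N K ->
  exists p : {poly R}, [/\ (size p <= (size s + 2 * size K).+1)%N,
    all (root p) s, ~~ root p b & all (derivn_root p) K].
Proof.
move=> ubs K_gt0; have [T [uT TK KT]] := pair_cover K.
have T_gt0 : all [pred t | 0 < t.2]%N T by apply/allP => t /TK/(allP K_gt0).
have le_TK : (size T <= size K)%N.
  by apply: uniq_leq_size TK; apply: subseq_uniq uT; apply: prefix_subseq.
pose few_conditions N := (size s + 2 * size (levels_below N T) < N)%N.
have few_max : few_conditions (size s + 2 * size K).+1.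
  rewrite /few_conditions ltnS leq_add2l leq_mul2l.
  exact: leq_trans (size_levels_below _ _) le_TK.
have few_exists : exists N, few_conditions N by exists (size s + 2 * size K).+1.
case: (ex_minnP few_exists) => N few_N minN.
have [|p [p0 le_pN]] := @exists_poly_derivn_roots R N
    ([seq (x, 0%N) | x <- s] ++ level_pairs (levels_below N T)).
  by rewrite size_cat size_map size_level_pairs.
rewrite all_cat all_map => /andP[root_s].
move=> /(derivn_root_levels_below le_pN) root_T.
exists p; split=> //; first exact: leq_trans le_pN (minN _ few_max).
- apply/negP => root_b.
  have root_bs : all (root p) (b :: s) by rewrite /= root_b.
  have /minN : few_conditions (size p).-1.
    rewrite /few_conditions -ltnS prednK ?size_poly_gt0 //.
    exact: (max_poly_roots_pairs uT root_T p0 T_gt0 ubs root_bs).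
  by rewrite leqNgt prednK ?size_poly_gt0 // le_pN.
- by apply/allP => u /KT/(allP root_T).
Qed.

Lemma coef_XaddC_exp (R : comNzSemiRingType) (a : R) (e i : nat) :
  (('X + a%:P) ^+ e)`_i = a ^+ (e - i) *+ 'C(e, i).
Proof.
have -> : ('X + a%:P) ^+ e = \poly_(j < e.+1) (a ^+ (e - j) *+ 'C(e, j)).
  rewrite addrC exprDn poly_def; apply: eq_bigr => j _.
  by rewrite -rmorphXn mul_polyC scalerMnl.
by rewrite coef_poly ltnS; case: leqP => // lt_ei; rewrite bin_small.
Qed.

Section Apolar.

Variables (R : comNzRingType) (n : nat) (p : {poly R}).

Definition apolar (q : {poly R}) : R :=
  \sum_(i < n.+1) p`_(n - i) * q`_i *+ ((n - i)`! * i`!).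

Fact apolar_is_scalar : scalar apolar.
Proof.
move=> k q r; rewrite /apolar mulr_sumr -big_split; apply: eq_bigr => i _ /=.
by rewrite coefD coefZ mulrDr mulrCA mulrnDl mulrnAr.
Qed.

HB.instance Definition _ :=
  GRing.isLinear.Build R {poly R} R *%R apolar apolar_is_scalar.

Lemma apolar_XaddC_exp (e : nat) (a : R) : (e <= n)%N -> (size p <= n.+1)%N ->
  apolar (('X + a%:P) ^+ e) = p^`(n - e).[a] *+ e`!.
Proof.
move=> le_en le_pn.
rewrite (@horner_coef_wide _ e.+1); last first.
  apply/leq_sizeP => j le_ej; rewrite coef_derivn nth_default ?mul0rn //.
  by apply: leq_trans le_pn _; lia.
rewrite -sumrMnl (reindex_inj rev_ord_inj) /apolar /=.
pose F i := p^`(n - e)`_(e.+1 - i.+1) * a ^+ (e.+1 - i.+1) *+ e`!.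
rewrite (big_ord_widen n.+1 F) // [RHS]big_mkcond {}/F.
apply: eq_bigr => i _; rewrite coef_XaddC_exp ltnS subSS coef_derivn.
have [le_ie|lt_ei] := leqP i e; last first.
  by rewrite bin_small // mulr0n mulr0 mul0rn.
have -> : (n - e + (e - i) = n - i)%N by lia.
rewrite mulrnAr mulrnAl -!mulrnA; congr (_ *+ _).
rewrite -(bin_fact le_ie) -(@ffact_fact (n - i) (n - e)); last by lia.
have -> : (n - i - (n - e) = e - i)%N by lia.
lia.
Qed.

End Apolar.

Lemma affine_power_sum_bound (R : rcfType) (n l : nat) (b : R) (s : seq R)
    (gamma : R -> R) (beta y : 'I_l -> R) (e : 'I_l -> nat) :
    uniq (b :: s) -> (forall i, e i < n)%N ->
    ('X + b%:P) ^+ n = \sum_(a <- s) gamma a *: ('X + a%:P) ^+ n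
      + \sum_(i < l) beta i *: ('X + (y i)%:P) ^+ e i ->
  (n < size s + 2 * l)%N.
Proof.
move=> ubs lt_en bE; rewrite ltnNge; apply/negP => le_n.
pose K := [seq (y i, n - e i)%N | i : 'I_l].
have K_gt0 : all [pred u | 0 < u.2]%N K.
  by apply/allP => _ /imageP[i _ ->] /=; rewrite subn_gt0.
have [p [le_p root_s root_b root_K]] := exists_separating_poly ubs K_gt0.
have size_p : (size p <= n.+1)%N.
  by apply: leq_trans le_p _; rewrite size_map size_enum_ord ltnS.
have apolar_eq0 c m a : (m <= n)%N -> root p^`(n - m) a ->
    apolar n p (c *: ('X + a%:P) ^+ m) = 0.
  move=> le_mn /rootP pa0.
  by rewrite linearZ /= apolar_XaddC_exp // pa0 mul0rn mulr0.
have : apolar n p (('X + b%:P) ^+ n) = 0.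
  rewrite bE linearD !linear_sum big1_seq => [|a /andP[_ /(allP root_s) ra]].
    rewrite add0r big1 // => i _; apply: apolar_eq0; first exact: ltnW.
    by apply: (allP root_K (_, _)); rewrite image_f.
  by apply: apolar_eq0; rewrite ?subnn.
apply/eqP; rewrite apolar_XaddC_exp // subnn derivn0 mulrn_eq0 negb_or.
by rewrite -lt0n fact_gt0.
Qed.

Theorem theorem15 (R : realType) (d l : nat)
    (beta y : 'I_l -> R) (e : 'I_l -> nat)
    (he : forall i : 'I_l, (e i <= d)%N)
    (hH : H2 R d = \sum_(i < l) beta i *: ('X + (y i)%:P) ^+ e i) :
  (d%:R - 1) / 2%:R < l%:R :> R.
Proof.
have lt_dl : (d.+1 < 1 + 2 * l)%N.
  apply: (@affine_power_sum_bound R d.+1 l 1 [:: 0] (fun=> 1) beta y e _ he).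
    by rewrite /= inE oner_neq0.
  by rewrite big_seq1 -hH scale1r addr0 [RHS]addrC subrK.
by rewrite ltr_pdivrMr ?ltr0n // ltrBlDr -natrM natr1 ltr_nat; lia.
Qed.
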